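(* Let $\mathcal{M}=(\mathbb{R}^2,\nabla)$ be a Type $\mathcal{A}$ surface which is not flat. \begin{enumerate} \item Let $\mu=0$. Then $E(0,\nabla)=\operatorname{Span}\{1\}$ or, up to linear equivalence, one of the following holds: (a) $\Gamma_{11}{}^1=1$, $\Gamma_{12}{}^1=0$, $\Gamma_{22}{}^1=0$, and $E(0,\nabla)=\operatorname{Span}\{1,e^{x^1}\}$; (b) $\Gamma_{11}{}^1=\Gamma_{12}{}^1=\Gamma_{22}{}^1=0$, and $E(0,\nabla)=\operatorname{Span}\{1,x^1\}$. \item Let $\mu=-1$. Then $\dim\{E(-1,\nabla)\}=3$. \item Let $\mu\in\mathbb{R}$, $\mu\neq 0,-1$. Then $\dim\{E(\mu,\nabla)\}=2$ if $\operatorname{rank}\rho_\nabla=1$, and $\dim\{E(\mu,\nabla)\}=0$ if $\operatorname{rank}\rho_\nabla=2$. \end{enumerate}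
   Context: A Type $\mathcal{A}$ surface here is $\mathbb{R}^2$ with coordinates $(x^1,x^2)$ and a torsion free connection $\nabla$, $\nabla_{\partial_{x^i}}\partial_{x^j}=\Gamma_{ij}{}^k\partial_{x^k}$, whose Christoffel symbols $\Gamma_{ij}{}^k=\Gamma_{ji}{}^k\in\mathbb{R}$ are constant. Two Type $\mathcal{A}$ surfaces are linearly equivalent if they are intertwined by the action of an element of the general linear group $GL(2,\mathbb{R})$ on $\mathbb{R}^2$. The Hessian is $\mathcal{H}_\nabla f=(\partial_{x^i}\partial_{x^j}f-\Gamma_{ij}{}^k\partial_{x^k}f)\,dx^i\otimes dx^j$. With $R_\nabla(x,y)=\nabla_x\nabla_y-\nabla_y\nabla_x-\nabla_{[x,y]}$, the Ricci tensor is $\rho_\nabla(x,y)=\operatorname{Tr}\{z\mapsto R_\nabla(z,x)y\}$ (symmetric for Type $\mathcal{A}$ surfaces) and $\rho_{s,\nabla}$ is its symmetrization. An affine surface is flat if and only if $\rho_\nabla=0$. For $\mu\in\mathbb{R}$, $E(\mu,\nabla)=\{f\in C^\infty(\mathbb{R}^2):\mathcal{H}_\nabla f=\mu f\rho_{s,\nabla}\}$, a real vector space. *)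

(* Defs.v *)
From HB Require Import structures.
From mathcomp Require Import all_boot all_order all_algebra.
From mathcomp Require Import all_classical all_reals all_analysis.
Set Implicit Arguments.
Unset Strict Implicit.
Unset Printing Implicit Defensive.
Import Order.TTheory GRing.Theory Num.Theory.
Import numFieldNormedType.Exports.
Local Open Scope classical_set_scope.
Local Open Scope ring_scope.

Section LinearAlgebra.
Context {R : realType} {U : lmodType R}.
Implicit Types (s : seq U) (E : set U).

Definition lincomb s (c : 'I_(size s) -> R) : U := \sum_i c i *: s`_i.

Definition spanset s : set U := [set u | exists c, u = @lincomb s c].

Definition lin_indep s : Prop :=
  forall c, @lincomb s c = 0 -> forall i, c i = 0.

Definition has_dim E (n : nat) : Prop :=
  exists s, [/\ size s = n, lin_indep s & E = spanset s].

End LinearAlgebra.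

Section TypeA.
Context {R : realType}.

Notation plane := 'rV[R]_2.
Notation vfield := (plane -> plane).

(* The coordinate vector [\partial_{x^{i+1}}]: indices are 0-based, so the
   paper's x^1, x^2 are the coordinates 0 and 1. *)
Definition evec (i : 'I_2) : plane := delta_mx 0 i.

Fixpoint Ck {V : normedModType R} (k : nat) (f : plane -> V) : Prop :=
  if k is k'.+1 then
    (forall p, differentiable f p) /\
    (forall i, Ck k' (fun p => 'D_(evec i) f p))
  else continuous f.

Definition smooth {V : normedModType R} (f : plane -> V) : Prop :=
  forall k, Ck k f.

(* [christoffel i j k] is \Gamma_{ij}^k. *)
Record typeA := TypeA {
  christoffel :> 'I_2 -> 'I_2 -> 'I_2 -> R;
  christoffel_sym : forall i j k, christoffel i j k = christoffel j i k }.

Implicit Types (G : typeA) (X Y Z : vfield) (p x y z : plane).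

Definition cov G X Y : vfield := fun p =>
  'D_(X p) Y p + \row_k \sum_i \sum_j X p 0 i * Y p 0 j * G i j k.

Definition lie_bracket X Y : vfield := fun p => 'D_(X p) Y p - 'D_(Y p) X p.

Definition curv_op G X Y Z : vfield := fun p =>
  cov G X (cov G Y Z) p - cov G Y (cov G X Z) p - cov G (lie_bracket X Y) Z p.

(* The curvature is tensorial, so its value on tangent vectors at p may be
   computed by extending them to vector fields with constant coefficients. *)
Definition curvature G p x y z : plane :=
  curv_op G (fun=> x) (fun=> y) (fun=> z) p.

Definition flat G : Prop := forall p x y z, curvature G p x y z = 0.

Definition ricci G p x y : R := \tr (lin1_mx (fun z => curvature G p z x y)).

Definition ricci_mx G p : 'M[R]_2 := \matrix_(i, j) ricci G p (evec i) (evec j).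

Definition ricci_sym G p x y : R := (ricci G p x y + ricci G p y x) / 2.

Definition ricci_rank G (r : nat) : Prop := forall p, \rank (ricci_mx G p) = r.

Definition hessian G (f : plane -> R) p (i j : 'I_2) : R :=
  'D_(evec i) ('D_(evec j) f) p
  - \sum_k G i j k * 'D_(evec k) f p.

Definition Espace (mu : R) G : set (plane -> R) :=
  [set f | smooth f /\ forall p i j,
    hessian G f p i j = mu * f p * ricci_sym G p (evec i) (evec j)].

(* GL(2,R) acts on row vectors, T p = p *m A. *)
Definition pushforward (A : 'M[R]_2) X : vfield :=
  fun q => X (q *m invmx A) *m A.

Definition lin_equiv G G' : Prop :=
  exists2 A : 'M[R]_2, A \in unitmx &
    forall X Y, smooth X -> smooth Y ->
      pushforward A (cov G X Y) = cov G' (pushforward A X) (pushforward A Y).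

Definition xcoord (i : 'I_2) : plane -> R := fun p => p 0 i.

End TypeA.

Arguments typeA : clear implicits.

(* Main.v *)
(* For f in E(mu), the 1-jet F = (f, f_1, f_2) satisfies d_i F = A_i F with
   constant 3x3 matrices A_i, so F is determined by F(0), and the commutator of
   A_0 and A_1 annihilates F.  The Codazzi identity for the Ricci tensor r turns
   this into (1 + mu) (r_{0j} f_1 - r_{1j} f_0) = 0.
   If mu = -1 the matrices commute and exp(x_0 A_0) exp(x_1 A_1) gives a full
   3-dimensional solution space.  Otherwise, if r has rank 2 then df = 0; if
   r = c w (x) w then df = g w, and the Codazzi identity forces
   G_{ij}^k w_k = a w_i w_j, so that (f, g) solves a commuting 2x2 system.
   For mu = 0, after rescaling w so that a is 0 or 1, the linear coordinates with
   first coordinate w bring the connection to the stated normal forms. *)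
Require Import Defs.
From HB Require Import structures.
From mathcomp Require Import all_boot all_order all_algebra.
From mathcomp Require Import all_classical all_reals all_analysis.
From mathcomp Require Import ring.
Set Implicit Arguments.
Unset Strict Implicit.
Unset Printing Implicit Defensive.
Import Order.TTheory GRing.Theory Num.Theory.
Import numFieldNormedType.Exports.
Local Open Scope classical_set_scope.
Local Open Scope ring_scope.

(** * Calculus rules for directional derivatives of scalar functions *)

Section PointwiseDerive.
Context {R : numFieldType} {V : normedModType R}.

Lemma is_derive_mulf (f g : V -> R) x v (df dg : R) :
  is_derive x v f df -> is_derive x v g dg ->
  is_derive x v (fun y => f y * g y) (df * g x + f x * dg).
Proof.
move=> hf hg; apply: (is_derive_eq (is_deriveM hf hg)).
by rewrite addrC /GRing.scale /= [g x * _]mulrC.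
Qed.

Lemma is_derive_sumf n (f : 'I_n -> V -> R) x v (df : 'I_n -> R) :
  (forall i, is_derive x v (f i) (df i)) ->
  is_derive x v (fun y => \sum_i f i y) (\sum_i df i).
Proof. by move=> h; have := is_derive_sum h; rewrite fct_sumE. Qed.

Lemma is_derive_mulcf (c : R) (f : V -> R) x v (df : R) :
  is_derive x v f df -> is_derive x v (fun y => c * f y) (c * df).
Proof. by move=> h; exact: (is_deriveZ c h). Qed.

Lemma is_derive_unique (f : V -> R) x v (a b : R) :
  is_derive x v f a -> is_derive x v f b -> a = b.
Proof. by move=> h1 h2; rewrite -(@derive_val _ _ _ _ _ _ _ h1) derive_val. Qed.

End PointwiseDerive.

(** * Exponential generating series of sequences of geometric growth *)

Section ExpSeries.
Context {R : realType}.
Implicit Types (u : nat -> R) (b c t x : R).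

(** Differentiating this series shifts [u], so the exponential of a matrix can be handled entry by
    entry. *)
Definition expgen u t : R := limn (pseries (fun k => u k / k`!%:R) t).

Definition geom_bounded u : Prop := exists c b, forall k, `|u k| <= c * b ^+ k.

Lemma geom_bounded_shift u : geom_bounded u -> geom_bounded (fun k => u k.+1).
Proof.
by move=> [c [b h]]; exists (c * b), b => k; rewrite -mulrA -exprS.
Qed.

(** Absolute convergence, by comparison with [|c|] times the exponential series at [|b| * |x|]. *)
Lemma cvg_expgen u x : geom_bounded u ->
  cvgn (pseries (fun k => u k / k`!%:R) x).
Proof.
move=> [c [b h]]; apply: normed_cvg; rewrite /normed_series_of /=.
apply: (@series_le_cvg _ _ (fun k => `|c| * exp_coeff (`|b| * `|x|) k)).
- by move=> k; exact: normr_ge0.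
- move=> k; rewrite mulr_ge0 // /exp_coeff /= divr_ge0 ?exprn_ge0 ?mulr_ge0 //.
- move=> k; rewrite /exp_coeff /= !normrM normfV normrX normr_nat exprMn.
  rewrite !mulrA -mulrA [_^-1 * _]mulrC mulrA; apply: ler_wpM2r => //.
  apply: ler_wpM2r; first exact: exprn_ge0.
  by apply: (le_trans (h k)); rewrite -normrX -normrM ler_norm.
- have := @is_cvg_series_exp_coeff R (`|b| * `|x|).
  by move=> h1; exact: (@is_cvg_seriesZ _ _ `|c| h1).
Qed.

Lemma is_derive_expgen u t : geom_bounded u ->
  is_derive t 1 (expgen u) (expgen (fun k => u k.+1) t).
Proof.
have E v : pseries_diffs (fun k => v k / k`!%:R) = (fun k => v k.+1 / k`!%:R).
  apply/funext => k; rewrite /pseries_diffs factS natrM invfM mulrCA mulVKf //.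
move=> h; have h1 := geom_bounded_shift h; have h2 := geom_bounded_shift h1.
(* Termwise differentiation at [t] needs convergence of the series and of its first two formal
   derivatives at a point of larger modulus, here [|t| + 1]. *)
have := @pseries_snd_diffs R (fun k => u k / k`!%:R) (`|t| + 1) t.
rewrite !E; apply; [exact: cvg_expgen..|].
by rewrite [ltRHS]ger0_norm ?addr_ge0 // ltrDl.
Qed.

Lemma expgen_sum n (c : 'I_n -> R) (u : 'I_n -> nat -> R) t :
  (forall i, geom_bounded (u i)) ->
  expgen (fun k => \sum_i c i * u i k) t = \sum_i c i * expgen (u i) t.
Proof.
move=> h; apply: cvg_lim => //.
have -> : pseries (fun k => (\sum_i c i * u i k) / k`!%:R) t =
  (fun N => \sum_i c i * pseries (fun k => u i k / k`!%:R) t N).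
  apply/funext => N; rewrite /pseries /series /=.
  under [RHS]eq_bigr do rewrite mulr_sumr.
  rewrite exchange_big /=; apply: eq_bigr => k _.
  by rewrite !mulr_suml; apply: eq_bigr => i _; rewrite -!mulrA.
apply: cvg_big => [|i _]; first exact: add_continuous.
by apply: cvgMr; exact: cvg_expgen.
Qed.

Lemma expgen0 u : expgen u 0 = u 0.
Proof.
(* Every partial sum with at least one term equals [u 0]; the empty one must be skipped. *)
apply: cvg_lim => //; apply: cvg_near_cst; exists 1%N => // N /= N0.
rewrite /pseries /series /=; case: N N0 => // N _.
rewrite big_nat_recl //= expr0 fact0 divr1 mulr1 big1 ?addr0 // => i _.
by rewrite expr0n mulr0.
Qed.

End ExpSeries.


(** * The matrix exponential and uniqueness for linear systems with constant coefficients *)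

Section MatrixExp.
Context {R : realType} {n : nat}.
Implicit Types (A B : 'M[R]_n) (t : R).

Definition expm A t : 'M[R]_n := \matrix_(i, j) expgen (fun k => (A ^+ k) i j) t.

(** The sum of the absolute values of all entries bounds every row sum, hence serves as the ratio in
    an induction on [k]. *)
Lemma geom_bounded_expmx A i j : geom_bounded (fun k => (A ^+ k) i j).
Proof.
exists 1, (\sum_i \sum_j `|A i j|) => k; rewrite mul1r.
elim: k i => [|k IH] i.
  by rewrite !expr0 mxE; case: (_ == _); rewrite ?normr1 ?normr0.
rewrite exprS mxE (le_trans (ler_norm_sum _ _ _)) //.
rewrite exprS.
apply: (@le_trans _ _ (\sum_l `|A i l| * (\sum_i \sum_j `|A i j|) ^+ k)).
  by apply: ler_sum => l _; rewrite normrM ler_wpM2l.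
rewrite -mulr_suml ler_wpM2r //.
  by rewrite exprn_ge0 // !sumr_ge0 // => *; rewrite sumr_ge0.
by rewrite [leRHS](bigD1 i) //= lerDl sumr_ge0 // => *; rewrite sumr_ge0.
Qed.

Lemma expm_comm A B t : A *m B = B *m A -> expm A t *m B = B *m expm A t.
Proof.
move=> AB; have ABk k : A ^+ k *m B = B *m A ^+ k.
  by elim: k => [|k IH]; rewrite ?expr0 ?mul1mx ?mulmx1 // exprS -mulmxA IH !mulmxA AB.
apply/matrixP => i j; rewrite !mxE.
under eq_bigr do rewrite mxE mulrC.
under [RHS]eq_bigr do rewrite mxE.
rewrite -!expgen_sum; try by move=> *; exact: geom_bounded_expmx.
congr expgen; apply/funext => k; have /matrixP/(_ i j) := ABk k; rewrite !mxE => <-.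
by apply: eq_bigr => l _; rewrite mulrC.
Qed.

Lemma is_derive_expm A t i j :
  is_derive t 1 (fun s => expm A s i j) ((A *m expm A t) i j).
Proof.
rewrite [X in is_derive _ _ X _](_ : _ = expgen (fun k => (A ^+ k) i j)); last first.
  by apply/funext => s; rewrite mxE.
apply: is_derive_eq; first exact/is_derive_expgen/geom_bounded_expmx.
rewrite mxE; under [RHS]eq_bigr do rewrite mxE.
rewrite -expgen_sum; last by move=> l; exact: geom_bounded_expmx.
by congr expgen; apply/funext => k; rewrite exprS mxE.
Qed.

Lemma expm0 A : expm A 0 = 1%:M.
Proof. by apply/matrixP => i j; rewrite mxE expgen0 expr0. Qed.

(* [u |-> expm A (s - u) F(u)] is constant; compare its values at 0 and [s]. *)
Lemma linear_ode_unique A (F : 'I_n -> R -> R) :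
  (forall j t, is_derive t 1 (F j) (\sum_k A j k * F k t)) ->
  forall j s, F j s = \sum_k expm A s j k * F k 0.
Proof.
move=> hF j s.
pose H u := \sum_k expm A (s - u) j k * F k u.
have hH (u : R) : is_derive u 1 H 0.
  have hE k : is_derive u 1 (fun u => expm A (s - u) j k)
      (- (A *m expm A (s - u)) j k).
    have hs : is_derive u (1 : R) (fun u => s - u) (0 - 1).
      exact: is_deriveB (is_derive_cst s u 1) (is_derive_id u 1).
    have := @is_derive1_comp _ _ (fun u => s - u) _ _ _
      (is_derive_expm A (s - u) j k) hs.
    move=> h; apply: (is_derive_eq h).
    by rewrite sub0r mulrN1.
  apply: (is_derive_eq
    (is_derive_sumf (fun k => is_derive_mulf (hE k) (hF k u)))).
  rewrite big_split /= -(expm_comm _ (erefl (A *m A))).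
  under eq_bigr do rewrite mxE mulNr mulr_suml.
  rewrite sumrN; apply/eqP; rewrite addrC subr_eq0; apply/eqP.
  under eq_bigr do rewrite mulr_sumr.
  by rewrite exchange_big /=; apply: eq_bigr => l _; apply: eq_bigr => k _; rewrite mulrA.
have := is_derive_0_is_cst s 0 hH; rewrite /H subr0 subrr expm0 => <-.
rewrite (bigD1 j) //= mxE eqxx mul1r big1 ?addr0 // => k kj.
by rewrite mxE eq_sym (negPf kj) mul0r.
Qed.

End MatrixExp.

(** * Directional derivatives and smoothness on the plane *)

Section Planar.
Context {R : realType}.
Notation plane := 'rV[R]_2.
Implicit Types (p q : plane) (f : plane -> R).

Lemma evecE i k : (evec i : plane) 0 k = (k == i)%:R.
Proof. by rewrite mxE eqxx. Qed.

(** The two difference quotients are the same function of [h]; this reduces questions on the plane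
    to one variable. *)
Lemma is_derive_line f p q (t df : R) :
  is_derive (t *: q + p) q f df ->
  is_derive t 1 (fun s => f (s *: q + p)) df.
Proof.
have E : (fun h : R => h^-1 *:
           (((fun s => f (s *: q + p)) \o shift t) (h *: 1) - f (t *: q + p))) =
         (fun h : R => h^-1 *: ((f \o shift (t *: q + p)) (h *: q) - f (t *: q + p))).
  by apply/funext => h /=; rewrite [h *: 1]mulr1 scalerDl addrA.
move=> [h1 h2]; split; first by rewrite /derivable E.
by rewrite -h2 /derive E.
Qed.

Lemma is_derive_evec f p q : differentiable f p ->
  is_derive p q f (\sum_i q 0 i * 'D_(evec i) f p).
Proof.
move=> df; have := derivableP (diff_derivable (v := q) df).
move=> h; apply: (is_derive_eq h).
rewrite deriveE // {1}[q]row_sum_delta linear_sum; apply: eq_bigr => i _.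
by rewrite linearZ deriveE.
Qed.

Lemma differentiable_coordf (g : R -> R) i p :
  derivable g (p 0 i) 1 -> differentiable (fun y : plane => g (y 0 i)) p.
Proof.
move=> /derivable1_diffP h.
exact: (differentiable_comp (differentiable_coord p 0 i) h).
Qed.

Lemma is_derive_coordf (g : R -> R) i p q dg :
  is_derive (p 0 i) 1 g dg ->
  is_derive p q (fun y : plane => g (y 0 i)) (q 0 i * dg).
Proof.
move=> hg; have /differentiable_coordf df : derivable g (p 0 i) 1 by case: hg.
have h := derivableP (diff_derivable (v := q) df).
(* The derivative is identified on the line through [p] with direction [q], where the one-variable
   chain rule applies. *)
apply: (is_derive_eq h); apply: is_derive_unique.
  by apply: (@is_derive_line _ p q 0); rewrite scale0r add0r; exact: h.
have hl : is_derive (0 : R) (1 : R) (fun s => (s *: q + p) 0 i) (q 0 i).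
  have -> : (fun s : R => (s *: q + p) 0 i) = (fun s => q 0 i * s + p 0 i).
    by apply/funext => s; rewrite !mxE mulrC.
  have := is_deriveD (is_deriveZ (q 0 i) (is_derive_id (0 : R) 1))
    (is_derive_cst (p 0 i) (0 : R) 1).
  by move=> h'; apply: (is_derive_eq h'); rewrite addr0 /GRing.scale /= mulr1.
rewrite mulrC; apply: (@is_derive1_comp _ g (fun s => (s *: q + p) 0 i)) hl.
by rewrite scale0r add0r.
Qed.

Lemma differentiable_mulf f g p : differentiable f p -> differentiable g p ->
  differentiable (fun y => f y * g y) p.
Proof. exact: differentiableM. Qed.

Lemma differentiable_sumf n (f : 'I_n -> plane -> R) p :
  (forall i, differentiable (f i) p) -> differentiable (fun y => \sum_i f i y) p.
Proof. by move=> h; have := differentiable_sum h; rewrite fct_sumE. Qed.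

Lemma derive_sumZ n (c : 'I_n -> R) (f : 'I_n -> plane -> R) p q :
  (forall i, derivable (f i) p q) ->
  'D_q (fun y => \sum_i c i * f i y) p = \sum_i c i * 'D_q (f i) p.
Proof.
move=> h; apply: derive_val; apply: is_derive_sumf => i.
exact/is_derive_mulcf/derivableP.
Qed.

Lemma differentiable_sumZ n (c : 'I_n -> R) (f : 'I_n -> plane -> R) p :
  (forall i, differentiable (f i) p) ->
  differentiable (fun y => \sum_i c i * f i y) p.
Proof.
by move=> h; apply: differentiable_sumf => i; exact: (differentiableZ (c i) (h i)).
Qed.

Lemma Ck_sumZ k n (c : 'I_n -> R) (f : 'I_n -> plane -> R) :
  (forall i, Ck k (f i)) -> Ck k (fun y => \sum_i c i * f i y).
Proof.
elim: k n c f => [|k IH] n c f h.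
  apply: (@continuous_big _ _ _ _ _ _ _ _ (fun i y => c i * f i y)) => [|i _ p].
    exact: add_continuous.
  by apply: cvgMr; [exact: (nbhs_filter p)|exact: h].
split=> [p|i]; first by apply: differentiable_sumZ => i; exact: (h i).1.
rewrite [X in Ck _ X](_ : _ = fun p => \sum_j c j * 'D_(evec i) (f j) p).
  by apply: IH => j; exact: (h j).2.
by apply/funext => p; apply: derive_sumZ => j; exact/diff_derivable/(h j).1.
Qed.

Lemma smooth_differentiable f p : smooth f -> differentiable f p.
Proof. by move=> /(_ 1%N) [h _]; exact: h. Qed.

Lemma smooth_derive f i : smooth f -> smooth (fun p => 'D_(evec i) f p).
Proof. by move=> h k; have [_] := h k.+1; apply. Qed.

End Planar.

(** * Total differential systems with constant coefficients on the plane *)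

Section Holonomic.
Context {R : realType} {n : nat}.
Notation plane := 'rV[R]_2.
Implicit Types (A : 'I_2 -> 'M[R]_n) (F : 'I_n -> plane -> R) (p q : plane).

(** The system d_i F = A_i F. Differentiability is enough to ask for, since the equations themselves
    give smoothness. *)
Definition holonomic A F : Prop :=
  forall j p, differentiable (F j) p /\
    forall i, 'D_(evec i) (F j) p = \sum_k A i j k * F k p.

Lemma holonomic_smooth A F j : holonomic A F -> smooth (F j).
Proof.
move=> h k; elim: k j => [|k IH] j.
  by move=> p; apply: differentiable_continuous; exact: (h j p).1.
split=> [p|i]; first exact: (h j p).1.
rewrite [X in Ck _ X](_ : _ = fun p => \sum_l A i j l * F l p).
  exact: Ck_sumZ.
by apply/funext => p; exact: (h j p).2.
Qed.

Lemma holonomic_is_derive A F j p q : holonomic A F ->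
  is_derive p q (F j) (\sum_k (\sum_i q 0 i *: A i) j k * F k p).
Proof.
move=> h; apply: (is_derive_eq (is_derive_evec q (h j p).1)).
under eq_bigr do rewrite (h j p).2 mulr_sumr.
rewrite exchange_big; apply: eq_bigr => k _ /=.
by rewrite summxE mulr_suml; apply: eq_bigr => i _; rewrite mxE mulrA.
Qed.

(** Along a line of direction [q] the system is an ordinary one, with matrix q_0 A_0 + q_1 A_1. *)
Lemma holonomic_line A F j p q (s : R) : holonomic A F ->
  F j (s *: q + p) = \sum_k expm (\sum_i q 0 i *: A i) s j k * F k p.
Proof.
move=> h; have := @linear_ode_unique _ _ (\sum_i q 0 i *: A i)
  (fun j s => F j (s *: q + p)) _ j s.
rewrite scale0r add0r; apply => l t.
exact/is_derive_line/holonomic_is_derive.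
Qed.

Lemma holonomic_unique A F F' : holonomic A F -> holonomic A F' ->
  (forall j, F j 0 = F' j 0) -> F = F'.
Proof.
move=> h h' e; apply/funext => j; apply/funext => p.
have := holonomic_line j 0 p 1 h; have := holonomic_line j 0 p 1 h'.
rewrite scale1r addr0 => -> ->.
by apply: eq_bigr => k _; rewrite e.
Qed.

Lemma sum_evec A i : \sum_k (evec i : plane) 0 k *: A k = A i.
Proof.
rewrite (bigD1 i) //= evecE eqxx scale1r big1 ?addr0 // => k ki.
by rewrite evecE (negPf ki) scale0r.
Qed.

(* Differentiating [F(t e_1 + y) = expm (A 1) t F(y)] in [y] along [e_0] and
   then in [t] replaces the symmetry of mixed partial derivatives. *)
Lemma holonomic_compat A F j p : holonomic A F ->
  \sum_k (A 0 *m A 1) j k * F k p = \sum_k (A 1 *m A 0) j k * F k p.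
Proof.
move=> h.
have E t : \sum_k A 0 j k * F k (t *: evec 1 + p) =
           \sum_k expm (A 1) t j k * \sum_l A 0 k l * F l p.
  apply: (@is_derive_unique _ _ (fun s : R => F j (s *: evec 0 + (t *: evec 1 + p))) 0 1).
    apply: is_derive_line; rewrite scale0r add0r -[in X in is_derive _ _ _ X](sum_evec A).
    exact: holonomic_is_derive.
  rewrite [X in is_derive _ _ X _](_ : _ =
     fun s : R => \sum_k expm (A 1) t j k * F k (s *: evec 0 + p)); last first.
    by apply/funext => s; rewrite addrCA (holonomic_line _ _ _ _ h) sum_evec.
  apply: is_derive_sumf => k; apply: is_derive_mulcf.
  apply: is_derive_line; rewrite scale0r add0r -[in X in is_derive _ _ _ X](sum_evec A).
  exact: holonomic_is_derive.
have := @is_derive_unique _ _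
   (fun t : R => \sum_k A 0 j k * F k (t *: evec 1 + p)) 0 1
   (\sum_k A 0 j k * \sum_l A 1 k l * F l p)
   (\sum_k A 1 j k * \sum_l A 0 k l * F l p).
have D (B C : 'M[R]_n) :
    \sum_k B j k * (\sum_l C k l * F l p) = \sum_k (B *m C) j k * F k p.
  under eq_bigr do rewrite mulr_sumr.
  rewrite exchange_big; apply: eq_bigr => k _ /=.
  by rewrite mxE mulr_suml; apply: eq_bigr => l _; rewrite mulrA.
rewrite !D; apply.
  rewrite -D; apply: is_derive_sumf => k; apply: is_derive_mulcf.
  apply: is_derive_line; rewrite scale0r add0r -[in X in is_derive _ _ _ X](sum_evec A).
  exact: holonomic_is_derive.
rewrite -D; under [X in is_derive _ _ X _]eq_fun do rewrite E.
apply: is_derive_sumf => k.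
have := is_derive_mulf (is_derive_expm (A 1) 0 j k)
  (is_derive_cst (\sum_l A 0 k l * F l p) (0 : R) 1).
by rewrite mulr0 addr0 expm0 mulmx1.
Qed.

Lemma holonomic_sum A m (c : 'I_m -> R) (F : 'I_m -> 'I_n -> plane -> R) :
  (forall i, holonomic A (F i)) -> holonomic A (fun j p => \sum_i c i * F i j p).
Proof.
move=> h j p; split; first by apply: differentiable_sumZ => i; exact: (h i j p).1.
move=> i; rewrite derive_sumZ; last by move=> l; exact/diff_derivable/(h l j p).1.
under eq_bigr do rewrite (h _ _ _).2 mulr_sumr.
rewrite exchange_big; apply: eq_bigr => k _ /=.
by rewrite mulr_sumr; apply: eq_bigr => l _; rewrite mulrCA.
Qed.

(** Component [j] of column [k] of exp(x_0 A_0) exp(x_1 A_1): for commuting matrices, the solution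
    whose value at the origin is the [k]-th unit vector. *)
Definition fundsol A (k j : 'I_n) p : R :=
  (expm (A 0) (p 0 0) *m expm (A 1) (p 0 1)) j k.

Lemma fundsol0 A k j : fundsol A k j 0 = (j == k)%:R.
Proof.
have z i : (0 : plane) 0 i = 0 by rewrite mxE.
by rewrite /fundsol !z !expm0 mulmx1 mxE.
Qed.

Lemma holonomic_fundsol A k : A 0 *m A 1 = A 1 *m A 0 ->
  holonomic A (fundsol A k).
Proof.
move=> AA j p.
have -> : fundsol A k j = fun p => \sum_l expm (A 0) (p 0 0) j l * expm (A 1) (p 0 1) l k.
  by apply/funext => y; rewrite /fundsol mxE.
split=> [|i].
  have E (B : 'M[R]_n) i l m : differentiable (fun p : plane => expm B (p 0 i) l m) p.
    apply: (@differentiable_coordf _ (fun t => expm B t l m)).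
    by case: (is_derive_expm B (p 0 i) l m).
  by apply: differentiable_sumf => l; exact: differentiable_mulf.
have D q : is_derive p q (fun p => \sum_l expm (A 0) (p 0 0) j l * expm (A 1) (p 0 1) l k)
  (\sum_l (q 0 0 * (A 0 *m expm (A 0) (p 0 0)) j l * expm (A 1) (p 0 1) l k +
           expm (A 0) (p 0 0) j l * (q 0 1 * (A 1 *m expm (A 1) (p 0 1)) l k))).
  have E (B : 'M[R]_n) i0 l m : is_derive p q (fun p => expm B (p 0 i0) l m)
      (q 0 i0 * (B *m expm B (p 0 i0)) l m).
    exact: (@is_derive_coordf _ (fun t => expm B t l m) _ p q _ (is_derive_expm _ _ _ _)).
  by apply: is_derive_sumf => l; exact: (is_derive_mulf (E _ _ _ _) (E _ _ _ _)).
rewrite (@derive_val _ _ _ _ _ _ _ (D _)) big_split /=.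
have -> : \sum_k0 A i j k0 * fundsol A k k0 p =
  (A i *m expm (A 0) (p 0 0) *m expm (A 1) (p 0 1)) j k.
  by rewrite -mulmxA mxE; apply: eq_bigr.
have [-> | ->] : i = 0 \/ i = 1.
  by case: i => -[|[]] // ?; [left|right]; apply: val_inj.
- rewrite [X in _ + X]big1 => [|l _]; last by rewrite evecE /= mul0r mulr0.
  rewrite addr0 [RHS]mxE; apply: eq_bigr => l _; by rewrite evecE /= mul1r.
- rewrite big1 ?add0r => [|l _]; last by rewrite evecE /= !mul0r.
  (* Differentiating the second factor leaves [A 1] between the two exponentials; commutation
     identifies this with [A 1] in front. *)
  rewrite -(expm_comm _ AA) -mulmxA [RHS]mxE; apply: eq_bigr => l _.
  by rewrite evecE /= mul1r.
Qed.

End Holonomic.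

(** * Dimension of solution spaces *)

(** Bridges families indexed by ['I_n] and the sequences of [has_dim], whose sums run over ordinals
    below [size s]; the two index types differ by a cast. *)
Lemma has_dim_basis (R : realType) (U : lmodType R) (E : set U) n (b : 'I_n -> U) :
  (forall c : 'I_n -> R, \sum_i c i *: b i = 0 -> forall i, c i = 0) ->
  (forall u, E u <-> exists c : 'I_n -> R, u = \sum_i c i *: b i) ->
  has_dim E n.
Proof.
move=> indep span; set s := [seq b i | i <- enum 'I_n].
have ss : size s = n by rewrite size_map size_enum_ord.
have sE (c : 'I_(size s) -> R) : lincomb c = \sum_(i < n) c (cast_ord (esym ss) i) *: b i.
  rewrite /lincomb (reindex (cast_ord (esym ss))) /=; last first.
    by apply: onW_bij; exists (cast_ord ss); [exact: cast_ordKV | exact: cast_ordK].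
  apply: eq_bigr => i _; rewrite (nth_map i) ?size_enum_ord //=.
  by rewrite nth_ord_enum.
exists s; split=> //.
  move=> c; rewrite sE => /indep c0 i.
  by have := c0 (cast_ord ss i); rewrite cast_ordK.
apply/seteqP; split=> u.
  move=> /span[c ->]; exists (fun i => c (cast_ord ss i)).
  by rewrite sE; apply: eq_bigr => i _; rewrite cast_ordKV.
by move=> [c ->]; apply/span; rewrite sE; exists (fun i => c (cast_ord (esym ss) i)).
Qed.

(** The value at the origin identifies solutions of a commuting system with R^n. As component [j]
    determines the whole solution, the space of [j]-th components has the same dimension. *)
Lemma holonomic_has_dim (R : realType) n (A : 'I_2 -> 'M[R]_n) (j : 'I_n)
    (E : set ('rV[R]_2 -> R)) :
  A 0 *m A 1 = A 1 *m A 0 ->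
  (forall F, holonomic A F -> F j = cst 0 -> forall i p, F i p = 0) ->
  (forall f, E f <-> exists2 F, holonomic A F & f = F j) ->
  has_dim E n.
Proof.
move=> AA inj EP.
pose F (c : 'I_n -> R) (i : 'I_n) p := \sum_k c k * fundsol A k i p.
have hF c : holonomic A (F c).
  by apply: holonomic_sum => k; exact: holonomic_fundsol.
have F0 c i : F c i 0 = c i.
  rewrite /F (bigD1 i) //= fundsol0 eqxx mulr1 big1 ?addr0 // => k ki.
  by rewrite fundsol0 eq_sym (negPf ki) mulr0.
have FE c : F c j = \sum_k c k *: fundsol A k j.
  by apply/funext => p; rewrite fct_sumE.
apply: (@has_dim_basis _ _ _ _ (fun k => fundsol A k j)).
  by move=> c; rewrite -FE => /(inj _ (hF c)) c0 i; rewrite -(F0 c) c0.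
move=> f; split=> [/EP[F' hF' ->]|[c ->]].
  exists (fun i => F' i 0); rewrite -FE.
  by congr (_ j); apply: (holonomic_unique hF' (hF _)) => i; rewrite F0.
by apply/EP; exists (F c).
Qed.

Section TwoIndices.

Lemma ord2_ind (P : 'I_2 -> Prop) : P 0 -> P 1 -> forall i, P i.
Proof.
by move=> P0 P1; case=> -[|[|//]] h;
  [rewrite (_ : Ordinal h = 0) | rewrite (_ : Ordinal h = 1)] => //;
  exact: val_inj.
Qed.

Lemma sum_ord2 (V : nmodType) (F : 'I_2 -> V) : \sum_i F i = F 0 + F 1.
Proof.
rewrite !big_ord_recl big_ord0 addr0; congr (F _ + F _); exact: val_inj.
Qed.

End TwoIndices.

(** * Curvature and Ricci tensor as polynomials in the Christoffel symbols *)

Section Curvature.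
Context {R : realType}.
Notation plane := 'rV[R]_2.
Implicit Types (G : typeA R) (x y z p : plane) (i j k l : 'I_2).

Definition christ G x y : plane := \row_k \sum_i \sum_j x 0 i * y 0 j * G i j k.

(** The components of the Ricci tensor: the symbols being constant, only their quadratic terms
    survive. [ricciE] links this to [ricci]. *)
Definition ric G i j : R :=
  \sum_l \sum_k (G l k l * G i j k - G i k l * G l j k).

Lemma christoffel10 G k : G 1 0 k = G 0 1 k.
Proof. exact: christoffel_sym. Qed.

Lemma curvatureE G p x y z :
  curvature G p x y z = christ G x (christ G y z) - christ G y (christ G x z).
Proof.
have covc X y' p' : cov G X (cst y') p' = christ G (X p') y'.
  by rewrite /cov derive_cst add0r.
have covC x' y' : cov G (cst x') (cst y') = cst (christ G x' y').
  by apply/funext => q; exact: covc.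
rewrite /curvature /curv_op !covC !covc /lie_bracket !derive_cst subrr.
rewrite [X in _ - X](_ : _ = 0) ?subr0 //.
apply/rowP => k; rewrite !mxE !big1 // => i _.
by rewrite big1 // => j _; rewrite mxE !mul0r.
Qed.

(** In dimension two the Ricci tensor determines the curvature: R(x,y)z = r(y,z)x - r(x,z)y, a
    polynomial identity checked on components. Hence vanishing Ricci components imply flatness. *)
Lemma curvature_ric G p x y z :
  curvature G p x y z =
  (\sum_i \sum_j y 0 i * z 0 j * ric G i j) *: x -
  (\sum_i \sum_j x 0 i * z 0 j * ric G i j) *: y.
Proof.
rewrite curvatureE; apply/rowP => k.
rewrite !mxE !sum_ord2 /= !mxE !sum_ord2 /ric !sum_ord2 !christoffel10.
by elim/ord2_ind: k; ring.
Qed.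

Lemma ric_sym G i j : ric G i j = ric G j i.
Proof.
rewrite /ric !sum_ord2; elim/ord2_ind: i; elim/ord2_ind: j; rewrite ?christoffel10; ring.
Qed.

(* The covariant derivative of the Ricci tensor is totally symmetric. *)
Lemma ric_codazzi G i j l :
  \sum_k G i j k * ric G l k = \sum_k G l j k * ric G i k.
Proof.
rewrite /ric !sum_ord2; elim/ord2_ind: i; elim/ord2_ind: j;
  elim/ord2_ind: l; rewrite ?christoffel10; ring.
Qed.

Lemma ricciE G p i j : ricci G p (evec i) (evec j) = ric G i j.
Proof.
(* The map z -> r(x,y)z - r(z,y)x has trace 2 r(x,y) - r(x,y). *)
rewrite /ricci /mxtrace; under eq_bigr do rewrite mxE curvature_ric !sum_ord2.
rewrite sum_ord2 !mxE.
by elim/ord2_ind: i; elim/ord2_ind: j; rewrite /= ?(ric_sym G 1 0); ring.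
Qed.

Lemma ricci_symE G p i j : ricci_sym G p (evec i) (evec j) = ric G i j.
Proof.
rewrite /ricci_sym !ricciE (ric_sym G j) -mulr2n -[_ *+ 2]mulr_natr.
by rewrite mulfK // pnatr_eq0.
Qed.

Lemma flat_ric G : (forall i j, ric G i j = 0) -> flat G.
Proof.
move=> h p x y z; rewrite curvature_ric.
by rewrite !sum_ord2 !h !mulr0 !addr0 !scale0r subrr.
Qed.

End Curvature.

(** * The Hessian equation as a first order system on 1-jets *)

Section HessianSystem.
Context {R : realType}.
Notation plane := 'rV[R]_2.
Implicit Types (G : typeA R) (mu : R) (f : plane -> R) (p : plane).

Lemma EspaceP mu G f : Espace mu G f <-> smooth f /\
  forall p i j, 'D_(evec i) ('D_(evec j) f) p =
    mu * ric G i j * f p + \sum_k G i j k * 'D_(evec k) f p.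
Proof.
split=> -[sf h]; split=> // p i j; have := h p i j; rewrite /hessian ricci_symE.
  by move=> /eqP; rewrite subr_eq => /eqP ->; rewrite mulrAC.
by move=> ->; rewrite addrK mulrAC.
Qed.

(* The closed first order system satisfied by the 1-jet [(f, f_1, f_2)]. *)
Definition jet_mx mu G i : 'M[R]_(1 + 2) :=
  block_mx 0 (evec i) (\col_j (mu * ric G i j)) (\matrix_(j, k) G i j k).

Definition jet f (j : 'I_(1 + 2)) : plane -> R :=
  match fintype.split j with inl _ => f | inr k => 'D_(evec k) f end.

Lemma jetl f (j : 'I_1) : jet f (lshift 2 j) = f.
Proof. by rewrite /jet (unsplitK (inl j)). Qed.

Lemma jetr f k : jet f (rshift 1 k) = 'D_(evec k) f.
Proof. by rewrite /jet (unsplitK (inr k)). Qed.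

Lemma jet_mxl mu G i (F : 'I_(1 + 2) -> R) :
  \sum_k jet_mx mu G i (lshift 2 0) k * F k = F (rshift 1 i).
Proof.
rewrite big_split_ord /= big_ord1 block_mxEul mxE mul0r add0r (bigD1 i) //=.
rewrite block_mxEur evecE eqxx mul1r big1 ?addr0 // => k ki.
by rewrite block_mxEur evecE (negPf ki) mul0r.
Qed.

Lemma jet_mxr mu G i j (F : 'I_(1 + 2) -> R) :
  \sum_k jet_mx mu G i (rshift 1 j) k * F k =
  mu * ric G i j * F (lshift 2 0) + \sum_k G i j k * F (rshift 1 k).
Proof.
rewrite big_split_ord /= big_ord1 block_mxEdl mxE; congr (_ + _).
by apply: eq_bigr => k _; rewrite block_mxEdr mxE.
Qed.

Lemma holonomic_jet mu G f : Espace mu G f -> holonomic (jet_mx mu G) (jet f).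
Proof.
move=> /EspaceP[sf h] j p; case: (split_ordP j) => [{}j|k] ->.
  rewrite jetl; split=> [|i]; first exact: smooth_differentiable.
  by rewrite (ord1 j) (jet_mxl _ _ _ (fun k => jet f k p)) jetr.
rewrite jetr; split=> [|i]; first exact/smooth_differentiable/smooth_derive.
rewrite h (jet_mxr _ _ _ _ (fun k => jet f k p)) jetl; congr (_ + _).
by apply: eq_bigr => l _; rewrite jetr.
Qed.

(** The top row of [jet_mx] forces the last two components to be the partial derivatives of the
    first; the lower rows are then the Hessian equation. *)
Lemma holonomic_jet_Espace mu G F : holonomic (jet_mx mu G) F ->
  Espace mu G (F (lshift 2 0)) /\ F = jet (F (lshift 2 0)).
Proof.
move=> h; have D i : 'D_(evec i) (F (lshift 2 0)) = F (rshift 1 i).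
  by apply/funext => p; rewrite (h _ p).2 (jet_mxl _ _ _ (fun k => F k p)).
split.
  apply/EspaceP; split=> [|p i j]; first exact: holonomic_smooth h.
  rewrite D (h _ p).2 (jet_mxr _ _ _ _ (fun k => F k p)); congr (_ + _).
  by apply: eq_bigr => k _; rewrite -D.
apply/funext => j; case: (split_ordP j) => [{}j|k] ->.
  by rewrite jetl (ord1 j).
by rewrite jetr D.
Qed.

(** The top row of A_i A_j has entries [mu * ric G j i] and [G j i k], both symmetric in [i] and
    [j]. *)
Lemma jet_mx_comml mu G k :
  (jet_mx mu G 0 *m jet_mx mu G 1) (lshift 2 0) k =
  (jet_mx mu G 1 *m jet_mx mu G 0) (lshift 2 0) k.
Proof.
rewrite !mxE !(jet_mxl _ _ _ (fun l => jet_mx _ _ _ l k)).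
case: (split_ordP k) => [{}k|{}k] ->.
  by rewrite !block_mxEdl !mxE ric_sym.
by rewrite !block_mxEdr !mxE christoffel_sym.
Qed.

(** In the column of [f] the difference vanishes by the Codazzi identity. In the other columns the
    Christoffel blocks contribute the curvature, which by [curvature_ric] has the same shape as the
    contribution of [mu * ric]; hence the factor [1 + mu]. *)
Lemma jet_mx_commr mu G j (k : 'I_(1 + 2)) :
  (jet_mx mu G 0 *m jet_mx mu G 1) (rshift 1 j) k =
  (jet_mx mu G 1 *m jet_mx mu G 0) (rshift 1 j) k +
  (1 + mu) * (ric G 0 j * (k == rshift 1 1)%:R - ric G 1 j * (k == rshift 1 0)%:R).
Proof.
rewrite !mxE !(jet_mxr _ _ _ _ (fun l => jet_mx _ _ _ l k)).
case: (split_ordP k) => [{}k|{}k] ->.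
  rewrite !block_mxEul !eq_lrshift !mulr0 subr0 mulr0 addr0 !mxE !mulr0 !add0r.
  under eq_bigr do rewrite block_mxEdl mxE mulrCA.
  under [RHS]eq_bigr do rewrite block_mxEdl mxE mulrCA.
  by rewrite -!mulr_sumr ric_codazzi.
rewrite !block_mxEur !evecE !(inj_eq (@rshift_inj _ _)).
under eq_bigr do rewrite block_mxEdr mxE.
under [X in _ = _ + X + _]eq_bigr do rewrite block_mxEdr mxE.
by elim/ord2_ind: k; elim/ord2_ind: j; rewrite /ric !sum_ord2 !christoffel10 /=; ring.
Qed.

Lemma Espace_ric mu G f p j : Espace mu G f -> mu != -1 ->
  ric G 0 j * 'D_(evec 1) f p = ric G 1 j * 'D_(evec 0) f p.
Proof.
move=> /holonomic_jet h mu1.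
have := holonomic_compat (rshift 1 j) p h.
under eq_bigr do rewrite jet_mx_commr mulrDl.
rewrite big_split /= => /eqP; rewrite -subr_eq0 [X in X - _]addrC addrK => /eqP.
rewrite big_split_ord big_ord1 sum_ord2 /= !jetr => h0.
have {h0} /eqP : (1 + mu) *
    (ric G 0 j * 'D_(evec 1) f p - ric G 1 j * 'D_(evec 0) f p) = 0.
  by rewrite -[RHS]h0; ring.
rewrite mulf_eq0.
have /negPf -> : 1 + mu != 0 by rewrite addrC -[1]opprK subr_eq0.
by rewrite /= subr_eq0 => /eqP.
Qed.

Lemma Espace_m1_dim G : has_dim (Espace (-1) G) 3.
Proof.
apply: (@holonomic_has_dim _ _ (jet_mx (-1) G) (lshift 2 0)).
- apply/matrixP => j k; case: (split_ordP j) => [{}j|{}j] ->.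
    by rewrite (ord1 j) jet_mx_comml.
  by rewrite jet_mx_commr subrr mul0r addr0.
- move=> F hF F0 i p; have [_ ->] := holonomic_jet_Espace hF.
  rewrite F0; case: (split_ordP i) => [{}i|k] ->; first by rewrite jetl.
  by rewrite jetr derive_cst.
- move=> f; split=> [fE|[F hF ->]]; last by case: (holonomic_jet_Espace hF).
  by exists (jet f); [exact: holonomic_jet | rewrite jetl].
Qed.

End HessianSystem.

(** * Ricci tensor of rank one *)

Section RankOne.
Context {R : realType}.
Notation plane := 'rV[R]_2.
Implicit Types (G : typeA R) (mu : R) (f : plane -> R) (w : 'I_2 -> R).

Definition ric_det G : R := ric G 0 0 * ric G 1 1 - ric G 0 1 * ric G 0 1.

(** The Ricci tensor is c w (x) w, and the last clause says that the constant 1-form [w] has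
    covariant derivative -a w (x) w. *)
Definition rank_one_form G w (a c : R) : Prop :=
  [/\ c != 0, exists i, w i != 0, forall i j, ric G i j = c * w i * w j
    & forall i j, \sum_k G i j k * w k = a * w i * w j].

Lemma sum_sqr_neq0 w : (exists i, w i != 0) -> w 0 * w 0 + w 1 * w 1 != 0.
Proof.
move=> [i wi]; rewrite -!expr2 paddr_eq0 ?sqr_ge0 // !expf_eq0 /= negb_and.
by move: wi; elim/ord2_ind: i => ->; rewrite ?orbT.
Qed.

Lemma rank_one_formP G : ~ flat G -> ric_det G = 0 ->
  exists w a c, rank_one_form G w a c.
Proof.
move=> nf d0.
have [w [c [c0 w0 hr]]] : exists w c, [/\ c != 0, exists i, w i != 0 &
    forall i j, ric G i j = c * w i * w j].
  have [r0|r0] := eqVneq (ric G 0 0) 0.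
    have r01 : ric G 0 1 = 0.
      by move/eqP: d0; rewrite /ric_det r0 mul0r sub0r oppr_eq0 mulf_eq0 orbb => /eqP.
    (* Only the entry [ric G 1 1] can be nonzero here. *)
    exists (fun i => (i == 1)%:R), (ric G 1 1); split.
    - apply/eqP => r11; apply: nf; apply: flat_ric => i j.
      by elim/ord2_ind: i; elim/ord2_ind: j; rewrite ?(ric_sym G 1 0).
    - by exists 1; rewrite eqxx oner_neq0.
    - move=> i j; elim/ord2_ind: i; elim/ord2_ind: j;
      by rewrite ?(ric_sym G 1 0) ?r0 ?r01 /= ?mulr0 ?mul0r ?mulr1.
  (* The vanishing determinant gives r_ij = r_0i r_0j / r_00. *)
  exists (fun i => ric G 0 i), (ric G 0 0)^-1; split.
  - by rewrite invr_eq0.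
  - by exists 0.
  - move=> i j; elim/ord2_ind: i; rewrite ?mulVf ?mul1r //.
    elim/ord2_ind: j; first by rewrite (ric_sym G 1 0) mulrAC mulVf ?mul1r.
    rewrite -mulrA; apply: (mulfI r0); rewrite mulVKf //.
    by apply/eqP; rewrite -subr_eq0 -/(ric_det G) d0.
pose S i j := \sum_k G i j k * w k.
(* After division by [c] the Codazzi identity reads S_ij w_l = S_lj w_i; with the symmetry of [S] it
   makes [S] a multiple of w (x) w, the factor being read off at an index where [w] is nonzero. *)
have SC i j l : S i j * w l = S l j * w i.
  have := ric_codazzi G i j l.
  under eq_bigr do rewrite hr mulrCA.
  under [in RHS]eq_bigr do rewrite hr mulrCA.
  rewrite -!mulr_sumr -/(S i j) -/(S l j) -!mulrA => /(mulfI c0).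
  by rewrite [w l * _]mulrC [w i * _]mulrC.
have Ssym i j : S i j = S j i by apply: eq_bigr => k _; rewrite christoffel_sym.
have [k wk] := w0.
exists w, (S k k / (w k * w k)), c; split=> // i j.
have e1 : S i j * w k = S k j * w i := SC i j k.
have e2 : S k j * w k = S k k * w j by rewrite Ssym SC.
rewrite -/(S i j) -[S i j](mulfK wk) e1 -[S k j](mulfK wk) e2; field.
by rewrite wk.
Qed.

(** The system f_i = w_i g, g_i = w_i (b f + a g). Both matrices are multiples of one companion
    matrix, so they commute. *)
Definition line_mx w (a b : R) (i : 'I_2) : 'M[R]_2 :=
  w i *: \matrix_(j, k) (if j == 0 then (k == 1)%:R else if k == 0 then b else a).

Lemma line_mx0 w a b i (F : 'I_2 -> R) :
  \sum_k line_mx w a b i 0 k * F k = w i * F 1.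
Proof. by rewrite sum_ord2 !mxE /= mulr0 mulr1 mul0r add0r. Qed.

Lemma line_mx1 w a b i (F : 'I_2 -> R) :
  \sum_k line_mx w a b i 1 k * F k = w i * (b * F 0 + a * F 1).
Proof. by rewrite sum_ord2 !mxE /= -!mulrA -mulrDr. Qed.

Lemma Espace_rank_one G w a c mu f : rank_one_form G w a c -> mu != -1 ->
  Espace mu G f <-> exists2 F, holonomic (line_mx w a (mu * c)) F & f = F 0.
Proof.
move=> [c0 w0 hr hG] mu1; have ww := sum_sqr_neq0 w0.
split=> [fE|[F hF ->]]; last first.
  have D i p : 'D_(evec i) (F 0) p = w i * F 1 p.
    by rewrite (hF 0 p).2 (line_mx0 _ _ _ _ (fun k => F k p)).
  apply/EspaceP; split=> [|p i j]; first exact: holonomic_smooth hF.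
  rewrite (_ : 'D_(evec j) (F 0) = fun p => w j * F 1 p); last exact/funext.
  transitivity (w j * (w i * (mu * c * F 0 p + a * F 1 p))).
    apply: derive_val; apply: is_derive_mulcf.
    have h := derivableP (diff_derivable (v := evec i) (hF 1 p).1).
    by apply: (is_derive_eq h); rewrite (hF 1 p).2 (line_mx1 _ _ _ _ (fun k => F k p)).
  under eq_bigr do rewrite D mulrA.
  by rewrite -mulr_suml hG hr; ring.
have [sf hf] := (EspaceP _ _ _).1 fE.
(* The factor [g] in df = g w is recovered as the inner product of df with [w] over the squared norm
   of [w]. *)
pose m := (w 0 * w 0 + w 1 * w 1)^-1.
pose g p := \sum_k (m * w k) * 'D_(evec k) f p.
have Df i p : 'D_(evec i) f p = w i * g p.
  (* For r = c w (x) w, [Espace_ric] says that df is parallel to [w]. *)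
  have e : w 0 * 'D_(evec 1) f p = w 1 * 'D_(evec 0) f p.
    have [l wl] := w0; apply: (mulfI (mulf_neq0 c0 wl)).
    by have := Espace_ric p l fE mu1; rewrite !hr => h; rewrite !mulrA ![c * w l * _]mulrAC.
  rewrite /g sum_ord2 -!mulrA -mulrDr; apply: (mulfI ww); rewrite mulrCA mulVKf //.
  by elim/ord2_ind: i; ring: e.
exists (fun j => if j == 0 then f else g) => //; elim/ord2_ind => p; split=> [|i].
- exact: smooth_differentiable.
- by rewrite (line_mx0 _ _ _ _ (fun k => (if k == 0 then f else g) p)) /= Df.
- apply: differentiable_sumZ => k; exact/smooth_differentiable/smooth_derive.
- rewrite (line_mx1 _ _ _ _ (fun k => (if k == 0 then f else g) p)) /=.
  rewrite /g derive_sumZ; last first.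
    by move=> k; exact/diff_derivable/smooth_differentiable/smooth_derive.
  rewrite -/(g p); under eq_bigr => k _.
    rewrite hf hr; under eq_bigr do rewrite Df mulrA.
    rewrite -mulr_suml hG; over.
  rewrite /= sum_ord2.
  transitivity (m * (w 0 * w 0 + w 1 * w 1) * (w i * (mu * c * f p + a * g p))).
    by ring.
  by rewrite mulVf // mul1r.
Qed.

Lemma Espace_rank_one_dim G w a c mu : rank_one_form G w a c -> mu != -1 ->
  has_dim (Espace mu G) 2.
Proof.
move=> hG mu1; apply: (@holonomic_has_dim _ _ (line_mx w a (mu * c)) 0).
- by rewrite /line_mx -!scalemxAl -!scalemxAr !scalerA mulrC.
- move=> F hF F0; elim/ord2_ind => p; first by rewrite F0.
  (* If f = 0 then w_i g = f_i = 0, and some w_i is nonzero. *)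
  have [_ [i wi] _ _] := hG; apply: (mulfI wi); rewrite mulr0.
  have := (hF 0 p).2 i; rewrite (line_mx0 _ _ _ _ (fun k => F k p)) F0.
  by rewrite derive_cst.
- by move=> f; exact: Espace_rank_one hG mu1.
Qed.

End RankOne.

(** * Ricci tensor of rank two *)

Section RankTwo.
Context {R : realType}.
Notation plane := 'rV[R]_2.
Implicit Types (G : typeA R) (mu : R) (f : plane -> R).

(** By [Espace_ric] the vector (f_1, -f_0) lies in the kernel of the Ricci matrix, which is
    invertible. *)
Lemma Espace_rank_two G mu f i p : ric_det G != 0 -> mu != -1 ->
  Espace mu G f -> 'D_(evec i) f p = 0.
Proof.
move=> d0 mu1 fE; apply: (mulfI d0); rewrite mulr0 /ric_det.
have := Espace_ric p 0 fE mu1; have := Espace_ric p 1 fE mu1.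
rewrite (ric_sym G 1 0) => e1 e0.
elim/ord2_ind: i.
  by rewrite mulrBl -!mulrA -e1 -e0; ring.
by rewrite mulrBl -!mulrA e1 mulrCA e0; ring.
Qed.

Lemma derive0_cst f : (forall p, differentiable f p) ->
  (forall i p, 'D_(evec i) f p = 0) -> f = cst (f 0).
Proof.
move=> df h; apply/funext => p /=.
have := @is_derive_0_is_cst _ (fun s : R => f (s *: p + 0)) 1 0.
rewrite scale1r scale0r !addr0; apply => s.
apply: is_derive_line; apply: (is_derive_eq (is_derive_evec p (df _))).
by rewrite big1 // => i _; rewrite h mulr0.
Qed.

Lemma smooth_cst (c : R) : smooth (cst c : plane -> R).
Proof.
move=> k; elim: k c => [|k IH] c; first exact: cst_continuous.
split=> [p|i]; first exact: differentiable_cst.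
rewrite (_ : (fun p => _) = cst 0); first exact: IH.
by apply/funext => p; rewrite derive_cst.
Qed.

Lemma spanset1 (u : plane -> R) f : spanset [:: u] f <-> exists c : R, f = c *: u.
Proof.
by split=> -[c ->]; [exists (c ord0) | exists (fun=> c)]; rewrite /lincomb big_ord1.
Qed.

Lemma spanset2 (u v : plane -> R) f :
  spanset [:: u; v] f <-> exists a b : R, f = a *: u + b *: v.
Proof.
split=> [[c ->]|[a [b ->]]].
  by exists (c 0), (c 1); rewrite /lincomb sum_ord2.
by exists (fun i => if i == 0 then a else b); rewrite /lincomb sum_ord2.
Qed.

Lemma Espace0_rank_two G : ric_det G != 0 -> Espace 0 G = spanset [:: cst 1].
Proof.
move=> d0; apply/seteqP; split=> f.
  move=> fE; have [sf _] := (EspaceP _ _ _).1 fE; apply/spanset1; exists (f 0).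
  rewrite (derive0_cst (f := f)).
  - by apply/funext => p /=; rewrite -[RHS]/(_ * 1) mulr1.
  - by move=> p; exact: smooth_differentiable.
  - by move=> i p; apply: (Espace_rank_two _ _ d0 _ fE); rewrite eq_sym oppr_eq0 oner_neq0.
move=> /spanset1[c ->]; have -> : c *: (cst 1 : plane -> R) = cst c.
  by apply/funext => p; rewrite -[LHS]/(_ * 1) mulr1.
have D i : 'D_(evec i) (cst c) = cst 0 :> (plane -> R).
  by apply/funext => p; rewrite derive_cst.
apply/EspaceP; split=> [|p i j]; first exact: smooth_cst.
by rewrite D derive_cst !mul0r add0r big1 // => k _; rewrite derive_cst mulr0.
Qed.

Lemma Espace_rank_two_dim G mu : ric_det G != 0 -> mu != 0 -> mu != -1 ->
  has_dim (Espace mu G) 0.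
Proof.
move=> d0 mu0 mu1; apply: (@has_dim_basis _ _ _ _ (fun=> 0)) => [c _ []//|f].
split=> [fE|[c ->]].
  exists (fun=> 0); rewrite big_ord0; apply/funext => p.
  have [_ hf] := (EspaceP _ _ _).1 fE.
  have D i : 'D_(evec i) f = cst 0.
    by apply/funext => q; exact: (Espace_rank_two _ _ d0 mu1 fE).
  (* Once df = 0, the Hessian equation reduces to mu r_ij f = 0. *)
  have h i j : ric G i j * f p = 0.
    have := hf p i j; rewrite D derive_cst big1 ?addr0 => [/esym|k _]; last first.
      by rewrite (Espace_rank_two _ _ d0 mu1 fE) mulr0.
    by rewrite -mulrA => /eqP; rewrite mulf_eq0 (negPf mu0) => /eqP.
  apply: (mulfI d0); rewrite mulr0 /ric_det mulrBl -!mulrA !h !mulr0.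
  exact: subrr.
rewrite big_ord0; have D i : 'D_(evec i) (0 : plane -> R) = cst 0.
  by apply/funext => p; exact: derive_cst.
apply/EspaceP; split=> [|p i j]; first exact: smooth_cst.
by rewrite D derive_cst mulr0 add0r big1 // => k _; rewrite derive_cst mulr0.
Qed.

Lemma det_mx2 (M : 'M[R]_2) : \det M = M 0 0 * M 1 1 - M 0 1 * M 1 0.
Proof.
have l0 : lift 0 0 = 1 :> 'I_2 by exact: val_inj.
have l1 : lift 1 0 = 0 :> 'I_2 by exact: val_inj.
rewrite (expand_det_row _ 0) sum_ord2 /cofactor !det_mx11 !mxE l0 l1 /=.
by rewrite expr0 expr1 mul1r mulN1r mulrN.
Qed.

Lemma ricci_mxE G p : ricci_mx G p = \matrix_(i, j) ric G i j.
Proof. by apply/matrixP => i j; rewrite !mxE ricciE. Qed.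

Lemma ricci_mx_unit G p : (\rank (ricci_mx G p) == 2) = (ric_det G != 0).
Proof.
rewrite -[_ == _]/(row_free _) row_free_unit unitmxE unitfE ricci_mxE.
by rewrite det_mx2 !mxE (ric_sym G 1 0).
Qed.

End RankTwo.

(** * The action of the general linear group on connections *)

Section LinearAction.
Context {R : realType}.
Notation plane := 'rV[R]_2.
Implicit Types (G : typeA R) (A : 'M[R]_2) (x y : plane).

(** The Christoffel symbols of the connection transported by p -> p A; the rows of [invmx A] are the
    preimages of the coordinate vectors. *)
Definition act_coef A G (i j k : 'I_2) : R :=
  (christ G (row i (invmx A)) (row j (invmx A)) *m A) 0 k.

Fact act_coef_sym A G i j k : act_coef A G i j k = act_coef A G j i k.
Proof.
congr ((_ *m A) 0 k); apply/rowP => l; rewrite !mxE exchange_big.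
apply: eq_bigr => a _; apply: eq_bigr => b _.
by rewrite christoffel_sym [X in X * _]mulrC.
Qed.

Definition act A G : typeA R := TypeA (act_coef_sym A G).

Lemma christ_act A G x y :
  christ (act A G) x y = christ G (x *m invmx A) (y *m invmx A) *m A.
Proof.
have dec (u : plane) : u *m invmx A = \sum_i u 0 i *: row i (invmx A).
  by rewrite mulmx_sum_row.
have bil u v (s t : 'I_2 -> R) (a b : 'I_2 -> plane) :
    u = \sum_i s i *: a i -> v = \sum_j t j *: b j ->
    christ G u v = \sum_i \sum_j (s i * t j) *: christ G (a i) (b j).
  move=> -> ->; apply/rowP => k; rewrite !sum_ord2 !mxE !sum_ord2 !mxE; ring.
rewrite (bil _ _ _ _ _ _ (dec x) (dec y)) mulmx_suml; apply/rowP => k.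
rewrite summxE mxE; apply: eq_bigr => i _; rewrite mulmx_suml summxE.
by apply: eq_bigr => j _; rewrite -scalemxAl mxE.
Qed.

Lemma is_derive_mulmxr (f : plane -> R) (B : 'M[R]_2) (q v : plane) (df : R) :
  is_derive (q *m B) (v *m B) f df -> is_derive q v (fun y => f (y *m B)) df.
Proof.
have E : (fun h : R => h^-1 *:
           (((fun y => f (y *m B)) \o shift q) (h *: v) - f (q *m B))) =
         (fun h : R => h^-1 *: ((f \o shift (q *m B)) (h *: (v *m B)) - f (q *m B))).
  by apply/funext => h /=; rewrite mulmxDl scalemxAl.
move=> [h1 h2]; split; first by rewrite /derivable E.
by rewrite -h2 /derive E.
Qed.

Lemma derive_pushforward A (Y : plane -> plane) q v :
  A \in unitmx -> smooth Y ->
  'D_v (Defs.pushforward A Y) q = 'D_(v *m invmx A) Y (q *m invmx A) *m A.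
Proof.
move=> uA sY; set B := invmx A.
have dY : derivable Y (q *m B) (v *m B).
  by apply: diff_derivable; have [h _] := sY 1%N; exact: h.
have H k : is_derive q v (fun y => Defs.pushforward A Y y 0 k)
    (('D_(v *m B) Y (q *m B) *m A) 0 k).
  rewrite [X in is_derive _ _ X _](_ : _ = fun y => \sum_l A l k * Y (y *m B) 0 l); last first.
    by apply/funext => y; rewrite mxE; apply: eq_bigr => l _; rewrite mulrC.
  rewrite (derive_mx dY) mxE; under eq_bigr do rewrite mxE mulrC.
  apply: is_derive_sumf => l; apply: is_derive_mulcf.
  apply: (@is_derive_mulmxr (fun y => Y y 0 l)).
  by have /derivable_mxP/(_ 0 l) := dY; exact: derivableP.
rewrite derive_mx; last first.
  by apply/derivable_mxP => i k; rewrite (ord1 i); case: (H k).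
by apply/rowP => k; rewrite mxE; apply: derive_val; exact: H.
Qed.

Lemma covE G (X Y : plane -> plane) p :
  cov G X Y p = 'D_(X p) Y p + christ G (X p) (Y p).
Proof. by []. Qed.

Lemma lin_equiv_act A G : A \in unitmx -> lin_equiv G (act A G).
Proof.
move=> uA; exists A => // X Y sX sY; apply/funext => q.
rewrite [RHS]covE christ_act derive_pushforward //.
by rewrite [LHS]/Defs.pushforward covE mulmxDl /Defs.pushforward !mulmxK.
Qed.

Lemma flat_act A G : A \in unitmx -> flat (act A G) -> flat G.
Proof.
move=> uA h p x y z.
have := h p (x *m A) (y *m A) (z *m A).
rewrite !curvatureE !christ_act !mulmxK // -mulmxBl.
by move=> /(congr1 (mulmx^~ (invmx A))); rewrite /= mulmxK // mul0mx.
Qed.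

(** The new first coordinate is the linear form w given by column 0 of [A]. The new symbols with
    upper index 0 are a w (x) w evaluated on the rows of [invmx A], where w takes the values 1 and
    0. *)
Lemma act_coord0 A G (a : R) :
  A \in unitmx ->
  (forall i j, \sum_k G i j k * A k 0 = a * A i 0 * A j 0) ->
  forall i j, act A G i j 0 = a * (i == 0)%:R * (j == 0)%:R.
Proof.
move=> uA hG i j; pose B := invmx A.
have hB l : \sum_m B l m * A m 0 = (l == 0)%:R.
  by have := mulVmx uA => /matrixP/(_ l 0); rewrite !mxE.
rewrite -!hB /= /act_coef mxE.
transitivity (\sum_m \sum_l B i m * B j l * (\sum_k G m l k * A k 0)).
  under eq_bigr do rewrite mxE mulr_suml.
  rewrite exchange_big; apply: eq_bigr => m _ /=.
  under eq_bigr do rewrite mulr_suml.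
  rewrite exchange_big; apply: eq_bigr => l _ /=.
  by rewrite mulr_sumr; apply: eq_bigr => k _; rewrite !mxE mulrA.
under [LHS]eq_bigr => m _ do under eq_bigr => l _ do rewrite hG.
by rewrite !sum_ord2; ring.
Qed.

End LinearAction.

(** * Normal forms in rank one, and their solutions for [mu = 0] *)

Section NormalForm.
Context {R : realType}.
Notation plane := 'rV[R]_2.
Implicit Types (G : typeA R) (a c : R) (f : plane -> R).

(** For nonzero [a], contracting the symbols with a w gives a^2 w (x) w, so replacing [w] by a w
    turns [a] into 1 and [c] into c / a^2. *)
Lemma rank_one_form_rescale G w a c : rank_one_form G w a c ->
  exists w' a' c', rank_one_form G w' a' c' /\ (a' = 0 \/ a' = 1).
Proof.
move=> hG; have [a0|a0] := eqVneq a 0; first by exists w, a, c; split=> //; left.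
have [c0 [i wi] hr hg] := hG.
exists (fun i => a * w i), 1, (c / (a * a)); split; last by right.
split; first by rewrite mulf_neq0 // invr_eq0 mulf_neq0.
- by exists i; rewrite mulf_neq0.
- by move=> k l; rewrite hr; field; rewrite a0.
- move=> k l; under eq_bigr do rewrite mulrCA.
  by rewrite -mulr_sumr hg; ring.
Qed.

Lemma rank_one_act G w a c : ~ flat G -> rank_one_form G w a c ->
  exists2 A, A \in unitmx &
    forall i j, act A G i j 0 = a * (i == 0)%:R * (j == 0)%:R.
Proof.
move=> nf [c0 w0 hr hg].
(* Column 0 is [w] and column 1 is [w] rotated by a right angle, so the determinant is the squared
   norm of [w]. *)
pose A : 'M[R]_2 :=
  \matrix_(i, j) (if j == 0 then w i else if i == 0 then - w 1 else w 0).
have uA : A \in unitmx.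
  by rewrite unitmxE unitfE det_mx2 !mxE /= mulNr opprK sum_sqr_neq0.
exists A => //; apply: act_coord0 => // i j; rewrite !mxE /= -hg.
by apply: eq_bigr => k _; rewrite mxE.
Qed.

(** These symbols make [ric G 0 1] and [ric G 1 1] vanish identically, so nonflatness leaves
    [ric G 0 0] nonzero. *)
Lemma normal_rank_one G a : ~ flat G ->
  (forall i j, G i j 0 = a * (i == 0)%:R * (j == 0)%:R) ->
  exists c, rank_one_form G (fun i => (i == 0)%:R) a c.
Proof.
move=> nf h; have r01 : ric G 0 1 = 0.
  by rewrite /ric !sum_ord2 !h /= christoffel10; ring.
have r11 : ric G 1 1 = 0 by rewrite /ric !sum_ord2 !h /=; ring.
exists (ric G 0 0); split.
- apply/eqP => r00; apply: nf; apply: flat_ric => i j.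
  by elim/ord2_ind: i; elim/ord2_ind: j; rewrite ?(ric_sym G 1 0).
- by exists 0; rewrite eqxx oner_neq0.
- move=> i j; elim/ord2_ind: i; elim/ord2_ind: j;
  by rewrite ?(ric_sym G 1 0) ?r01 ?r11 /= ?mulr0 ?mulr1.
- by move=> i j; rewrite sum_ord2 /= mulr1 mulr0 addr0.
Qed.

Lemma holonomic_coord a (b : R) (g0 g1 : R -> R) :
  (forall t : R, is_derive t 1 g0 (g1 t)) ->
  (forall t : R, is_derive t 1 g1 (b * g0 t + a * g1 t)) ->
  holonomic (line_mx (fun i => (i == 0)%:R) a b)
    (fun j p => (if j == 0 then g0 else g1) (p 0 0)).
Proof.
move=> h0 h1; elim/ord2_ind => p /=; split=> [|i].
- by apply: differentiable_coordf; case: (h0 (p 0 0)).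
- rewrite (line_mx0 _ _ _ _ (fun k => (if k == 0 then g0 else g1) (p 0 0))) /=.
  by rewrite [_ == _]eq_sym -evecE; apply: derive_val; exact: is_derive_coordf.
- by apply: differentiable_coordf; case: (h1 (p 0 0)).
- rewrite (line_mx1 _ _ _ _ (fun k => (if k == 0 then g0 else g1) (p 0 0))) /=.
  by rewrite [_ == _]eq_sym -evecE; apply: derive_val; exact: is_derive_coordf.
Qed.

(** For [mu = 0] the system in the first coordinate is f' = g, g' = a g, with solutions (s + t e, t
    e1). The identity and the exponential both fit as [e], for a = 0 and a = 1. *)
Lemma Espace0_normal G a c (e e1 : R -> R) :
  rank_one_form G (fun i => (i == 0)%:R) a c ->
  (forall t : R, is_derive t 1 e (e1 t)) ->
  (forall t : R, is_derive t 1 e1 (a * e1 t)) -> e1 0 = 1 ->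
  Espace 0 G = spanset [:: cst 1; e \o xcoord 0].
Proof.
move=> hG he he1 e10.
have m1 : (0 : R) != -1 by rewrite eq_sym oppr_eq0 oner_neq0.
pose F (s t : R) (j : 'I_2) (p : plane) :=
  (if j == 0 then fun x => s + t * e x else fun x => t * e1 x) (p 0 0).
have hF s t : holonomic (line_mx (fun i => (i == 0)%:R) a (0 * c)) (F s t).
  apply: holonomic_coord => x.
    have := is_deriveD (is_derive_cst s x 1) (is_derive_mulcf t (he x)).
    by move=> h; apply: (is_derive_eq h); rewrite add0r.
  by apply: (is_derive_eq (is_derive_mulcf t (he1 x))); ring.
have F0 s t : F s t 0 = s *: cst 1 + t *: (e \o xcoord 0).
  by apply/funext => p; rewrite -[RHS]/(s * 1 + t * e (p 0 0)) mulr1.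
apply/seteqP; split=> f.
  move=> /(Espace_rank_one _ hG m1)[F' hF' ->]; apply/spanset2.
  (* These coefficients match the values at the origin, using [e1 0 = 1]. *)
  exists (F' 0 0 - F' 1 0 * e 0), (F' 1 0); rewrite -F0.
  congr (_ 0); apply: holonomic_unique hF' (hF _ _) _.
  have z : (0 : plane) 0 0 = 0 by rewrite mxE.
  by elim/ord2_ind; rewrite /F /= z ?subrK // e10 mulr1.
move=> /spanset2[s [t ->]]; rewrite -F0.
by apply/(Espace_rank_one _ hG m1); exists (F s t).
Qed.

End NormalForm.

(** * Assembly of the cases by the value of [mu] and the rank of the Ricci tensor *)

Theorem theorem1p10 (R : realType) (G : typeA R) (nonflat : ~ flat G) :
  [/\ Espace 0 G = spanset [:: cst 1]
      \/ (exists G' : typeA R, lin_equiv G G' /\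
           ([/\ G' 0 0 0 = 1, G' 0 1 0 = 0, G' 1 1 0 = 0 &
               Espace 0 G' = spanset [:: cst 1; expR \o xcoord 0]]
            \/ [/\ G' 0 0 0 = 0, G' 0 1 0 = 0, G' 1 1 0 = 0 &
               Espace 0 G' = spanset [:: cst 1; xcoord 0]])),
      has_dim (Espace (-1) G) 3
    & forall mu : R, mu != 0 -> mu != -1 ->
        (ricci_rank G 1 -> has_dim (Espace mu G) 2) /\
        (ricci_rank G 2 -> has_dim (Espace mu G) 0)].
Proof.
split; last 1 first.
- move=> mu mu0 mu1; split=> /(_ 0) rk.
    have d0 : ric_det G = 0.
      by apply/eqP/negPn; rewrite -(ricci_mx_unit G 0) rk.
    have [w [a [c hG]]] := rank_one_formP nonflat d0.
    exact: Espace_rank_one_dim hG mu1.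
  by apply: Espace_rank_two_dim => //; rewrite -(ricci_mx_unit G 0) rk.
- have [d0|d0] := eqVneq (ric_det G) 0; last by left; exact: Espace0_rank_two.
  right; have [w0 [a0 [c0 hG0]]] := rank_one_formP nonflat d0.
  have [w [a [c [hG a01]]]] := rank_one_form_rescale hG0.
  have [A uA hA] := rank_one_act nonflat hG.
  exists (act A G); split; first exact: lin_equiv_act.
  have nf : ~ flat (act A G) by move=> /(flat_act uA).
  (* The rank one data are rebuilt from the normalized symbols, now with the first coordinate form
     as [w]. *)
  have [c' hG'] := normal_rank_one nf hA.
  move: a01 hA hG' => [->|->] hA hG'; [right|left].
  + split; rewrite ?hA /= ?mulr0 ?mul0r ?mulr1 //.
    apply: (Espace0_normal (e := id) (e1 := cst 1) hG') => // t.
    by rewrite mul0r; exact: is_derive_cst.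
  + split; rewrite ?hA /= ?mulr0 ?mul0r ?mulr1 //.
    apply: (Espace0_normal hG' (@is_derive_expR R) _ (@expR0 R)) => t.
    by rewrite mul1r; exact: is_derive_expR.
- exact: Espace_m1_dim.
Qed.
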